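(* A $4$-dimensional $pp$-wave $g_4=\sum_{i=1}^{2}(\mathrm{d}x^i)^2+2\,\mathrm{d}u\,(\mathrm{d}r+h\,\mathrm{d}u)$, with $h=h(x^1,x^2,u)$ a smooth real function, is Bach-flat if and only if, locally (i.e. in a neighbourhood of every point), it is of the form $$g_4=2\,\mathrm{d}u\Big(\mathrm{d}r+\left(\bar z\alpha+z\bar\alpha+\beta+\bar\beta\right)\mathrm{d}u\Big)+2\,\mathrm{d}z\,\mathrm{d}\bar z,$$ with $\alpha=\alpha(z,u)$, $\beta=\beta(z,u)$ functions of the complex variable $z$ and the real variable $u$ which are holomorphic in $z$.
   Context: Here $z=\frac{x^1+\mathrm{i}x^2}{\sqrt2}$ and $\bar z=\frac{x^1-\mathrm{i}x^2}{\sqrt2}$, so $2\,\mathrm dz\,\mathrm d\bar z=(\mathrm dx^1)^2+(\mathrm dx^2)^2$; the functions $\alpha,\beta$ are smooth. Bach-flat means that the Bach tensor $B_{ab}=\nabla_cC_{ab}{}^c-\mathsf P_{cd}W^c{}_{ab}{}^d$ vanishes, where $W$ is the Weyl tensor, $\mathsf P=\frac12\big(\mathrm{Ric}-\frac{\mathrm{scal}}{6}g\big)$ is the Schouten tensor (in dimension 4) and $C_{abc}=\nabla_c\mathsf P_{ab}-\nabla_b\mathsf P_{ac}$ is the Cotton tensor. *)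

(* Defs.v *)
From Stdlib Require Import Reals List Lra.
From Coquelicot Require Import Coquelicot.

Open Scope R_scope.

(** * Iterated partial derivatives and smoothness *)

Record coord_space := CoordSpace {
  pt :> UniformSpace;
  axis : Type;
  coord : axis -> pt -> R;
  upd : axis -> R -> pt -> pt   (* replaces one coordinate *)
}.

Arguments coord {c} _ _.
Arguments upd {c} _ _ _.

Section Smooth.

Context {E : coord_space}.

(* Coquelicot's [Derive] is total; the value is meaningful only where the
   partial derivative exists, as guaranteed on [D] by [smooth_on D]. *)
Definition partial (i : axis E) (f : E -> R) (p : E) : R :=
  Derive (fun t => f (upd i t p)) (coord i p).

Fixpoint partials (l : list (axis E)) (f : E -> R) : E -> R :=
  match l with
  | nil => f
  | cons i l' => partial i (partials l' f)
  end.

(* C^infinity on the open set [D]: partial derivatives of all orders exist and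
   are continuous at every point of [D]. *)
Definition smooth_on (D : E -> Prop) (f : E -> R) : Prop :=
  forall (l : list (axis E)) (p : E), D p ->
    continuous (partials l f) p /\
    forall i : axis E,
      ex_derive (fun t => partials l f (upd i t p)) (coord i p).

End Smooth.

Inductive axis3 := Y1 | Y2 | Y3.

Definition coord3 (i : axis3) (p : R * R * R) : R :=
  match p with (y1, y2, y3) =>
    match i with Y1 => y1 | Y2 => y2 | Y3 => y3 end
  end.

Definition upd3 (i : axis3) (t : R) (p : R * R * R) : R * R * R :=
  match p with (y1, y2, y3) =>
    match i with
    | Y1 => (t, y2, y3)
    | Y2 => (y1, t, y3)
    | Y3 => (y1, y2, t)
    end
  end.

(* Since Coquelicot's [C] is [R * R], the type [C * R] is also [R * R * R], with
   coordinates (Re z, Im z, u). *)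
Definition E3 : coord_space :=
  CoordSpace (prod_UniformSpace (prod_UniformSpace R_UniformSpace R_UniformSpace)
                                R_UniformSpace)
             axis3 coord3 upd3.

(* The coordinates (x^1, x^2, u, r). *)
Inductive axis4 := X1 | X2 | U | Rr.

Definition coord4 (i : axis4) (p : R * R * R * R) : R :=
  match p with (x1, x2, u, r) =>
    match i with X1 => x1 | X2 => x2 | U => u | Rr => r end
  end.

Definition upd4 (i : axis4) (t : R) (p : R * R * R * R) : R * R * R * R :=
  match p with (x1, x2, u, r) =>
    match i with
    | X1 => (t, x2, u, r)
    | X2 => (x1, t, u, r)
    | U => (x1, x2, t, r)
    | Rr => (x1, x2, u, t)
    end
  end.

Definition E4 : coord_space :=
  CoordSpace (prod_UniformSpace E3 R_UniformSpace) axis4 coord4 upd4.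

Definition sum4 (f : axis4 -> R) : R := f X1 + f X2 + f U + f Rr.

Definition kron (a b : axis4) : R :=
  match a, b with
  | X1, X1 | X2, X2 | U, U | Rr, Rr => 1
  | _, _ => 0
  end.

(** * Curvature of a pseudo-Riemannian metric in the coordinates of [E4] *)

Record metric := Metric {
  met : axis4 -> axis4 -> E4 -> R;      (* g_ab *)
  imet : axis4 -> axis4 -> E4 -> R;     (* g^ab *)
  met_sym : forall a b p, met a b p = met b a p;
  met_imet : forall a b p,
    sum4 (fun c => met a c p * imet c b p) = kron a b
}.

Section Curvature.

Variable g : metric.

Local Notation "'D' a" := (@partial E4 a) (at level 9, a at level 9).

(* Gamma^c_ab *)
Definition christoffel (c a b : axis4) (p : E4) : R :=
  / 2 * sum4 (fun d => imet g c d p *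
    (D a (met g b d) p + D b (met g a d) p - D d (met g a b) p)).

(* R_ab^c_d, with (nabla_a nabla_b - nabla_b nabla_a) V^c = R_ab^c_d V^d *)
Definition riemann_up (a b c d : axis4) (p : E4) : R :=
  D a (christoffel c b d) p - D b (christoffel c a d) p
  + sum4 (fun e => christoffel c a e p * christoffel e b d p
                   - christoffel c b e p * christoffel e a d p).

(* R_abcd *)
Definition riemann (a b c d : axis4) (p : E4) : R :=
  sum4 (fun e => met g c e p * riemann_up a b e d p).

(* Ric_bd = R_ab^a_d, which is positive on round spheres *)
Definition ricci (b d : axis4) (p : E4) : R :=
  sum4 (fun a => riemann_up a b a d p).

Definition scal_curv (p : E4) : R :=
  sum4 (fun a => sum4 (fun b => imet g a b p * ricci a b p)).

Definition schouten (a b : axis4) (p : E4) : R :=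
  / 2 * (ricci a b p - scal_curv p / 6 * met g a b p).

(* The totally trace-free part of R_abcd. *)
Definition weyl (a b c d : axis4) (p : E4) : R :=
  riemann a b c d p
  - (met g a c p * schouten b d p - met g b c p * schouten a d p
     + met g b d p * schouten a c p - met g a d p * schouten b c p).

(* nabla_c P_ab *)
Definition nabla_schouten (c a b : axis4) (p : E4) : R :=
  D c (schouten a b) p
  - sum4 (fun d => christoffel d c a p * schouten d b p
                   + christoffel d c b p * schouten a d p).

(* C_abc *)
Definition cotton (a b c : axis4) (p : E4) : R :=
  nabla_schouten c a b p - nabla_schouten b a c p.

(* nabla_d C_abc *)
Definition nabla_cotton (d a b c : axis4) (p : E4) : R :=
  D d (cotton a b c) p
  - sum4 (fun e => christoffel e d a p * cotton e b c p
                   + christoffel e d b p * cotton a e c p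
                   + christoffel e d c p * cotton a b e p).

(* B_ab = nabla_c C_ab^c - P_cd W^c_ab^d *)
Definition bach (a b : axis4) (p : E4) : R :=
  sum4 (fun c => sum4 (fun d => imet g c d p * nabla_cotton c a b d p))
  - sum4 (fun c => sum4 (fun d => schouten c d p *
      sum4 (fun e => sum4 (fun f =>
        imet g c e p * imet g d f p * weyl e a b f p)))).

End Curvature.

Definition bach_flat_on (M : E4 -> Prop) (g : metric) : Prop :=
  forall (p : E4), M p -> forall a b : axis4, bach g a b p = 0.

(* g(v, v) at the point p *)
Definition quadratic (g : metric) (p v : E4) : R :=
  sum4 (fun a => sum4 (fun b => met g a b p * coord (c := E4) a v * coord (c := E4) b v)).

(** * pp-waves *)

Definition xxu (p : E4) : E3 := fst p.

Definition pp_met (h : E3 -> R) (a b : axis4) (p : E4) : R :=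
  match a, b with
  | X1, X1 | X2, X2 | U, Rr | Rr, U => 1
  | U, U => 2 * h (xxu p)
  | _, _ => 0
  end.

Definition pp_imet (h : E3 -> R) (a b : axis4) (p : E4) : R :=
  match a, b with
  | X1, X1 | X2, X2 | U, Rr | Rr, U => 1
  | Rr, Rr => - (2 * h (xxu p))
  | _, _ => 0
  end.

Lemma pp_met_sym h a b p : pp_met h a b p = pp_met h b a p.
Proof. destruct a, b; reflexivity. Qed.

Lemma pp_met_imet h a b p :
  sum4 (fun c => pp_met h a c p * pp_imet h c b p) = kron a b.
Proof. destruct a, b; unfold sum4; simpl; ring. Qed.

Definition pp_wave (h : E3 -> R) : metric :=
  Metric (pp_met h) (pp_imet h) (pp_met_sym h) (pp_met_imet h).

Lemma pp_wave_quadratic (h : E3 -> R) (p : E4) (dx1 dx2 du dr : R) :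
  quadratic (pp_wave h) p (dx1, dx2, du, dr)
  = dx1 ^ 2 + dx2 ^ 2 + 2 * du * (dr + h (xxu p) * du).
Proof. unfold quadratic, sum4; simpl; ring. Qed.

(* z = (x^1 + i x^2) / sqrt 2; being linear, this is also the 1-form dz. *)
Definition zeta (p : E4) : C := (coord (c := E4) X1 p / sqrt 2, coord (c := E4) X2 p / sqrt 2).

Definition zu (p : E4) : C * R := (zeta p, coord (c := E4) U p).

Definition smooth_C_on (O : C * R -> Prop) (f : C * R -> C) : Prop :=
  smooth_on (E := E3) O (fun q => Re (f q)) /\
  smooth_on (E := E3) O (fun q => Im (f q)).

Definition holomorphic_in_z_on (O : C * R -> Prop) (f : C * R -> C) : Prop :=
  forall (z : C) (u : R), O (z, u) ->
    ex_derive (K := C_AbsRing) (V := C_NormedModule) (fun w : C => f (w, u)) z.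

(* The value on the tangent vector v at p of
   2 du (dr + (zbar alpha + z alphabar + beta + betabar) du) + 2 dz dzbar. *)
Definition normal_form (alpha beta : C * R -> C) (p v : E4) : C :=
  (let z := zeta p in
   let a := alpha (zu p) in
   let b := beta (zu p) in
   let du := RtoC (coord (c := E4) U v) in
   let dr := RtoC (coord (c := E4) Rr v) in
   2 * du * (dr + (Cconj z * a + z * Cconj a + b + Cconj b) * du)
   + 2 * zeta v * Cconj (zeta v))%C.

Definition locally_normal_form (M : E4 -> Prop) (g : metric) : Prop :=
  forall p : E4, M p ->
    exists (N : E4 -> Prop) (O : C * R -> Prop) (alpha beta : C * R -> C),
      open N /\ N p /\ (forall q, N q -> M q) /\
      open (T := E3) O /\ (forall q, N q -> O (zu q)) /\
      smooth_C_on O alpha /\ smooth_C_on O beta /\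
      holomorphic_in_z_on O alpha /\ holomorphic_in_z_on O beta /\
      (forall q v : E4, N q ->
         RtoC (quadratic g q v) = normal_form alpha beta q v).

(* Main.v *)
Require Import Defs.
From Stdlib Require Import Reals Lra List FunctionalExtensionality.
From Coquelicot Require Import Coquelicot.

(** Write [Delta] for the Laplacian in [(x^1, x^2)] and let [z] be as in [zeta],
    so that [Delta = 2 d_z d_zbar].  The null vector [d_r] is parallel, and every
    curvature quantity is a multiple of [du^2] or contracts with [d_r] to zero:
    [Ric = - Delta h du^2], the scalar curvature vanishes, and [- 2 B_uu] is
    [Delta^2 h], the only component of the Bach tensor that can be non-zero
    ([pp_bach]).  So Bach-flat means that [h] is biharmonic in [(x^1, x^2)] for
    each [u], and the normal form is Goursat's representation
    [h = 2 Re (zbar alpha + beta)] of such functions, with [u] as a smooth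
    parameter.

    If [alpha = A + i B] and [beta] are holomorphic, then the real and imaginary
    parts satisfy the Cauchy-Riemann equations, hence are harmonic, and
    [Delta h] is [4 sqrt 2 d_1 A] in the coordinates [(x^1, x^2)]; this is again
    the real part of a holomorphic function, so [Delta^2 h = 0]
    ([biharmonic_goursat]).

    Conversely, on a coordinate box, [k = Delta h / (4 sqrt 2)] is harmonic.  A
    harmonic conjugate [l] makes [k + i l] holomorphic; a primitive [A + i B] of
    it gives the function [alpha], and then the remainder
    [h - 2 Re (zbar alpha)] is harmonic, so it is twice the real part of a
    holomorphic [beta] ([goursat_exists]).  Both the conjugates and the primitive
    come from one lemma ([poincare]): a closed pair [P dx^1 + Q dx^2] depending
    smoothly on [u] has a potential that is smooth in all three variables.

    Smoothness means that iterated partial derivatives of every order exist and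
    are continuous, so it is proved by [smooth_coind]: it suffices to exhibit a
    class of continuous functions containing the given one and closed under
    partial derivatives.  The class for [poincare] is that of potentials of
    closed pairs, since the [u]-derivative of a potential is the potential of
    the [u]-derivatives. *)

Local Notation pd := (@partial E3).
Local Notation smooth := (@smooth_on E3).

(** * Curvature of a pp-wave *)

Definition lap (f : E3 -> R) (y : E3) : R :=
  partial (E := E3) Y1 (partial (E := E3) Y1 f) y
  + partial (E := E3) Y2 (partial (E := E3) Y2 f) y.

(** The operator on functions of [(x^1, x^2, u)] that corresponds to
    differentiation along an axis of [E4] after pulling back by [xxu]. *)
Definition partial_base (a : axis4) (f : E3 -> R) : E3 -> R :=
  match a with
  | X1 => partial (E := E3) Y1 f
  | X2 => partial (E := E3) Y2 f
  | U => partial (E := E3) Y3 f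
  | Rr => fun _ => 0
  end.

(** No differentiability is assumed: scaling commutes with [Derive] even at
    points where the derivative does not exist.  This lets the whole curvature
    computation run at every point, as long as each tensor component is a single
    multiple of a pulled-back function. *)
Lemma partial_pullback (a : axis4) (f : E3 -> R) (k : R) (p : E4) :
  partial (E := E4) a (fun q => k * f (xxu q)) p = k * partial_base a f (xxu p).
Proof.
  destruct p as [[[x1 x2] u] r]; unfold partial; rewrite Derive_scal; f_equal;
  destruct a; unfold xxu; simpl; try reflexivity; apply Derive_const.
Qed.

Lemma partial_const4 (a : axis4) (k : R) (p : E4) :
  partial (E := E4) a (fun _ => k) p = 0.
Proof. unfold partial; apply Derive_const. Qed.

(** The factors [1] and [-1] put every component in the form to which
    [partial_pullback] applies. *)
Definition pp_gamma (h : E3 -> R) (c a b : axis4) (p : E4) : R :=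
  match c, a, b with
  | X1, U, U => -1 * partial_base X1 h (xxu p)
  | X2, U, U => -1 * partial_base X2 h (xxu p)
  | Rr, U, U => 1 * partial_base U h (xxu p)
  | Rr, U, X1 | Rr, X1, U => 1 * partial_base X1 h (xxu p)
  | Rr, U, X2 | Rr, X2, U => 1 * partial_base X2 h (xxu p)
  | _, _, _ => 0
  end.

Lemma pp_christoffel h c a b : christoffel (pp_wave h) c a b = pp_gamma h c a b.
Proof.
  apply functional_extensionality; intro p; unfold christoffel, sum4; simpl.
  destruct c, a, b; simpl;
    unfold pp_met; rewrite ?(partial_pullback _ h), ?partial_const4; simpl; lra.
Qed.

(** The terms quadratic in the Christoffel symbols cancel: a product
    [Gamma^c_ae Gamma^e_bd] is non-zero only for [c = r] and [a = b = d = u], where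
    antisymmetrization in [a, b] kills it. *)
Lemma pp_riemann_up h a b c d p :
  riemann_up (pp_wave h) a b c d p
  = partial (E := E4) a (pp_gamma h c b d) p - partial (E := E4) b (pp_gamma h c a d) p.
Proof.
  unfold riemann_up, sum4; rewrite !pp_christoffel.
  destruct a, b; simpl; try ring; destruct c, d; simpl; ring.
Qed.

Definition only_uu (f : E3 -> R) (a b : axis4) (p : E4) : R :=
  match a, b with U, U => f (xxu p) | _, _ => 0 end.

Lemma pp_ricci h b d p :
  ricci (pp_wave h) b d p = only_uu (fun y => - lap h y) b d p.
Proof.
  unfold ricci, sum4; rewrite !pp_riemann_up; unfold lap.
  destruct b, d; unfold pp_gamma; rewrite ?partial_pullback, ?partial_const4; simpl; lra.
Qed.

Lemma pp_scal h p : scal_curv (pp_wave h) p = 0.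
Proof. unfold scal_curv, sum4; rewrite !pp_ricci; simpl; ring. Qed.

Lemma pp_schouten h a b :
  schouten (pp_wave h) a b = only_uu (fun y => - / 2 * lap h y) a b.
Proof.
  apply functional_extensionality; intro p; unfold schouten.
  rewrite pp_scal, pp_ricci; destruct a, b; simpl; lra.
Qed.

Lemma pp_nabla_schouten h c a b p :
  nabla_schouten (pp_wave h) c a b p
  = only_uu (fun y => - / 2 * partial_base c (lap h) y) a b p.
Proof.
  unfold nabla_schouten, sum4; rewrite !pp_schouten, !pp_christoffel.
  destruct a, b; unfold only_uu; rewrite ?partial_pullback, ?partial_const4;
   destruct c; simpl; ring.
Qed.
Definition pp_cotton (h : E3 -> R) (a b c : axis4) (p : E4) : R :=
  match a, b, c with
  | U, U, X1 => - / 2 * partial_base X1 (lap h) (xxu p)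
  | U, U, X2 => - / 2 * partial_base X2 (lap h) (xxu p)
  | U, X1, U => / 2 * partial_base X1 (lap h) (xxu p)
  | U, X2, U => / 2 * partial_base X2 (lap h) (xxu p)
  | _, _, _ => 0
  end.

Lemma pp_cotton_eq h a b c : cotton (pp_wave h) a b c = pp_cotton h a b c.
Proof.
  apply functional_extensionality; intro p; unfold cotton.
  rewrite !pp_nabla_schouten; destruct a, b, c; simpl; lra.
Qed.

(** The term [P_cd W^c_ab^d] reduces to [P_uu W^u_ab^u], that is to
    [P_uu W_rabr], which vanishes because [d_r] is parallel and null and [P_ra] is
    zero.  The divergence of the Cotton tensor contributes
    [d_1 C_uu1 + d_2 C_uu2]. *)
Lemma pp_bach h a b p :
  bach (pp_wave h) a b p = only_uu (fun y => - / 2 * lap (lap h) y) a b p.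
Proof.
  unfold bach, sum4.
  rewrite !pp_schouten.
  assert (HW : forall e f, weyl (pp_wave h) Rr e f Rr p = 0).
  { intros e f; unfold weyl, riemann, sum4; rewrite !pp_riemann_up, !pp_schouten.
    destruct e, f; unfold pp_gamma, only_uu;
      rewrite ?partial_pullback, ?partial_const4; simpl; ring. }
  unfold only_uu at 1 2 3 4 5 6 7 8 9 10 11 12 13 14 15 16.
  simpl. rewrite !HW.
  unfold nabla_cotton, sum4; rewrite !pp_cotton_eq, !pp_christoffel.
  unfold pp_cotton; generalize (lap h); intro k; unfold lap.
  destruct a, b; simpl; rewrite ?partial_pullback, ?partial_const4; simpl; lra.
Qed.

(** * Calculus of smooth functions of three variables *)

Definition is_pd (i : axis3) (f : E3 -> R) (l : R) (y : E3) : Prop :=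
  is_derive (fun t => f (upd3 i t y)) (coord3 i y) l.

Lemma is_pd_unique i f l y : is_pd i f l y -> pd i f y = l.
Proof. intros H; apply is_derive_unique; exact H. Qed.

Lemma upd3_coord3 i (y : E3) : upd3 i (coord3 i y) y = y.
Proof. destruct y as [[a b] c], i; reflexivity. Qed.

Lemma ball_upd3 i (y : E3) (e : posreal) t :
  ball (coord3 i y : R) e t -> ball y e (upd3 i t y).
Proof.
  destruct y as [[a b] c], i; simpl; intros H;
    (split; [split|]); simpl; try exact H; apply ball_center.
Qed.

Lemma locally_upd3 i (P : E3 -> Prop) (y : E3) :
  locally y P -> locally (coord3 i y : R) (fun t => P (upd3 i t y)).
Proof.
  intros [e He]; exists e; intros t Ht; apply He, ball_upd3, Ht.
Qed.

Lemma is_pd_ext_loc i f g l (y : E3) :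
  locally y (fun z => f z = g z) -> is_pd i f l y -> is_pd i g l y.
Proof.
  intros H; apply is_derive_ext_loc, (locally_upd3 i _ _ H).
Qed.

Lemma partials_app l i f : partials (E := E3) (l ++ i :: nil) f = partials l (pd i f).
Proof. induction l as [|j l IH]; [reflexivity | exact (f_equal (pd j) IH)]. Qed.

Lemma partials_ext (D : E3 -> Prop) f g :
  open D -> (forall y, D y -> f y = g y) ->
  forall l y, D y -> partials (E := E3) l f y = partials l g y.
Proof.
  intros HD Hfg l; induction l as [|i l IH]; intros y Hy; [exact (Hfg y Hy)|].
  apply (Derive_ext_loc (fun t => partials (E := E3) l f (upd3 i t y))).
  apply (locally_upd3 i (fun z => partials (E := E3) l f z = partials l g z) y).
  apply filter_imp with (2 := HD y Hy); exact IH.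
Qed.

Lemma smooth_continuous D f y : smooth D f -> D y -> continuous f y.
Proof. intros H Hy; exact (proj1 (H nil y Hy)). Qed.

Lemma smooth_is_pd D f i y : smooth D f -> D y -> is_pd i f (pd i f y) y.
Proof. intros H Hy; apply Derive_correct; exact (proj2 (H nil y Hy) i). Qed.

Lemma smooth_partial D f i : smooth D f -> smooth D (pd i f).
Proof. intros H l y Hy; rewrite <- partials_app; apply H, Hy. Qed.

Lemma smooth_sub (D D' : E3 -> Prop) f :
  (forall y, D' y -> D y) -> smooth D f -> smooth D' f.
Proof. intros HD H l y Hy; apply H, HD, Hy. Qed.

(** The list of directions is peeled off from its innermost end, because the
    class [S] controls the first derivative taken; the remaining ones apply to a
    function that agrees with a member of [S] on [D], which suffices as [D] is
    open. *)
Lemma smooth_coind (D : E3 -> Prop) (S : (E3 -> R) -> Prop) :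
  open D ->
  (forall f, S f -> forall y, D y -> continuous f y) ->
  (forall f, S f -> forall i, exists g, S g /\ forall y, D y -> is_pd i f (g y) y) ->
  forall f, S f -> smooth D f.
Proof.
  intros HD Hc Hp f Sf l; revert f Sf.
  induction l as [|i l IH] using rev_ind; intros f Sf y Hy.
  - split; [exact (Hc f Sf y Hy)|].
    intros i; destruct (Hp f Sf i) as [g [_ Hg]]; exists (g y); exact (Hg y Hy).
  - destruct (Hp f Sf i) as [g [Sg Hg]].
    assert (E : locally y (fun z => partials (E := E3) l g z
                                    = partials (l ++ i :: nil) f z)).
    { apply filter_imp with (2 := HD y Hy); intros z Hz; rewrite partials_app.
      symmetry; apply (partials_ext D); [exact HD| |exact Hz].
      intros w Hw; apply is_pd_unique, Hg, Hw. }
    destruct (IH g Sg y Hy) as [H1 H2]; split.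
    + exact (continuous_ext_loc _ _ _ E H1).
    + intros j; destruct (H2 j) as [m Hm]; exists m; revert Hm.
      apply is_pd_ext_loc, E.
Qed.

Lemma is_pd_plus i f g lf lg y :
  is_pd i f lf y -> is_pd i g lg y -> is_pd i (fun z => f z + g z) (lf + lg) y.
Proof. intros Hf Hg; apply (is_derive_plus (V := R_NormedModule) _ _ _ _ _ Hf Hg). Qed.

Lemma is_pd_mult i f g lf lg y :
  is_pd i f lf y -> is_pd i g lg y ->
  is_pd i (fun z => f z * g z) (lf * g y + f y * lg) y.
Proof.
  intros Hf Hg; generalize (is_derive_mult (K := R_AbsRing) _ _ _ _ _ Hf Hg Rmult_comm).
  rewrite upd3_coord3; intros H; exact H.
Qed.

Lemma is_pd_const i k y : is_pd i (fun _ => k) 0 y.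
Proof. exact (is_derive_const (V := R_NormedModule) k (coord3 i y : R_AbsRing)). Qed.

Lemma is_pd_coord i j y :
  is_pd i (coord3 j) (match i, j with Y1, Y1 | Y2, Y2 | Y3, Y3 => 1 | _, _ => 0 end) y.
Proof.
  destruct y as [[a b] c], i, j;
    first [exact (is_derive_id (K := R_AbsRing) _)
          | exact (is_derive_const (K := R_AbsRing) (V := R_NormedModule) _ _)].
Qed.

Lemma continuous_coord3 i (y : E3) : continuous (coord3 i) y.
Proof.
  apply filterlim_locally; intros e; exists e; intros [[a' b'] c'].
  destruct y as [[a b] c]; intros [[Ha Hb] Hc]; destruct i; assumption.
Qed.

(** A derivative of a product is a sum of two products, so the class to which
    [smooth_coind] is applied for products has to contain sums as well. *)
Inductive smooth_alg (D : E3 -> Prop) : (E3 -> R) -> Prop :=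
| alg_smooth f : smooth D f -> smooth_alg D f
| alg_const k : smooth_alg D (fun _ => k)
| alg_coord i : smooth_alg D (coord3 i)
| alg_plus f g : smooth_alg D f -> smooth_alg D g -> smooth_alg D (fun y => f y + g y)
| alg_mult f g : smooth_alg D f -> smooth_alg D g -> smooth_alg D (fun y => f y * g y).

Lemma smooth_alg_smooth D f : open D -> smooth_alg D f -> smooth D f.
Proof.
  intros HD; apply (smooth_coind D (smooth_alg D) HD); clear f; intros f Sf.
  - intros y Hy; induction Sf as [f Hf|k|i|f g _ Hf _ Hg|f g _ Hf _ Hg].
    + exact (smooth_continuous D f y Hf Hy).
    + apply continuous_const.
    + apply continuous_coord3.
    + apply (continuous_plus (V := R_NormedModule)); assumption.
    + apply (continuous_mult (K := R_AbsRing)); assumption.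
  - intros i; induction Sf as [f Hf|k|j|f g Sf Hf Sg Hg|f g Sf Hf Sg Hg].
    + exists (pd i f); split; [apply alg_smooth, smooth_partial, Hf|].
      intros y Hy; apply (smooth_is_pd D); assumption.
    + exists (fun _ => 0); split; [apply alg_const|intros y _; apply is_pd_const].
    + eexists; split; [|intros y _; apply is_pd_coord]; apply alg_const.
    + destruct Hf as [f' [Sf' Hf]], Hg as [g' [Sg' Hg]].
      exists (fun y => f' y + g' y); split; [apply alg_plus; assumption|].
      intros y Hy; apply is_pd_plus; auto.
    + destruct Hf as [f' [Sf' Hf]], Hg as [g' [Sg' Hg]].
      exists (fun y => f' y * g y + f y * g' y); split.
      * apply alg_plus; apply alg_mult; assumption.
      * intros y Hy; apply is_pd_mult; auto.
Qed.

Definition scale3 (c : R) (y : E3) : E3 :=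
  match y with (a, b, u) => (c * a, c * b, u) end.

Definition scale_factor (c : R) (i : axis3) : R :=
  match i with Y1 | Y2 => c | Y3 => 1 end.

Lemma is_pd_scale c i f l y :
  is_pd i f l (scale3 c y) ->
  is_pd i (fun z => f (scale3 c z)) (scale_factor c i * l) y.
Proof.
  intros H; apply (is_derive_ext (fun t => f (upd3 i (scale_factor c i * t) (scale3 c y)))).
  { intros t; destruct y as [[a b] u], i; simpl; rewrite ?Rmult_1_l; reflexivity. }
  apply (is_derive_comp (V := R_NormedModule) (fun s => f (upd3 i s (scale3 c y)))
           (fun t => scale_factor c i * t)).
  - replace (scale_factor c i * coord3 i y) with (coord3 i (scale3 c y)); [exact H|].
    destruct y as [[a b] u], i; simpl; rewrite ?Rmult_1_l; reflexivity.
  - auto_derive; [exact I|ring].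
Qed.

Lemma continuous_scale3 c y : continuous (scale3 c) y.
Proof.
  destruct y as [[a b] u].
  assert (L : forall x : R, continuous (fun t => c * t) x)
    by (intros x; apply (continuous_scal_r (K := R_AbsRing) (V := R_NormedModule)),
        continuous_id).
  apply filterlim_locally; intros e.
  destruct (proj1 (filterlim_locally _ _) (L a) e) as [d1 H1].
  destruct (proj1 (filterlim_locally _ _) (L b) e) as [d2 H2].
  assert (Hd : 0 < Rmin (Rmin d1 d2) e).
  { repeat apply Rmin_pos; apply cond_pos. }
  exists (mkposreal _ Hd); intros [[a' b'] u'] [[Ha Hb] Hu]; simpl in *.
  split; [split|]; simpl.
  - apply H1, (ball_le a _ d1 (Rle_trans _ _ _ (Rmin_l _ _) (Rmin_l _ _)) a' Ha).
  - apply H2, (ball_le b _ d2 (Rle_trans _ _ _ (Rmin_l _ _) (Rmin_r _ _)) b' Hb).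
  - apply (ball_le u _ e (Rmin_r _ _) u' Hu).
Qed.

Lemma open_scale3 c (D : E3 -> Prop) : open D -> open (fun y => D (scale3 c y)).
Proof. apply open_comp; intros y _; apply continuous_scale3. Qed.

Lemma smooth_scale c D f :
  open D -> smooth D f -> smooth (fun y => D (scale3 c y)) (fun y => f (scale3 c y)).
Proof.
  intros HD Hf.
  apply (smooth_coind _ (fun k => exists m g, smooth D g /\ k = fun y => m * g (scale3 c y))
           (open_scale3 c D HD)).
  - intros k [m [g [Hg ->]]] y Hy.
    apply (continuous_scal_r (K := R_AbsRing) (V := R_NormedModule)).
    apply (continuous_comp (scale3 c) g); [apply continuous_scale3|].
    exact (smooth_continuous D g _ Hg Hy).
  - intros k [m [g [Hg ->]]] i.
    exists (fun y => m * scale_factor c i * pd i g (scale3 c y)); split.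
    + exists (m * scale_factor c i), (pd i g); split; [apply smooth_partial, Hg|reflexivity].
    + intros y Hy; rewrite Rmult_assoc.
      apply (is_derive_scal (fun t => g (scale3 c (upd3 i t y)))).
      apply is_pd_scale, (smooth_is_pd D); assumption.
  - exists 1, f; split; [exact Hf|].
    apply functional_extensionality; intros y; ring.
Qed.

Lemma locally_2d_upd3 i j (P : E3 -> Prop) (y : E3) :
  locally y P ->
  locally_2d (fun s t => P (upd3 i s (upd3 j t y))) (coord3 i y) (coord3 j y).
Proof.
  intros [e He]; exists e; intros s t Hs Ht; apply He.
  destruct y as [[a b] c], i, j; simpl in *; (split; [split|]); simpl;
    first [exact Hs | exact Ht | apply ball_center].
Qed.

Lemma continuous_2d i j (f : E3 -> R) (y : E3) :
  continuous f y ->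
  continuity_2d_pt (fun s t => f (upd3 i s (upd3 j t y))) (coord3 i y) (coord3 j y).
Proof.
  intros H e.
  replace (f (upd3 i (coord3 i y) (upd3 j (coord3 j y) y))) with (f y)
    by now rewrite !upd3_coord3.
  exact (locally_2d_upd3 i j _ y (proj1 (filterlim_locally _ _) H e)).
Qed.

(** Schwarz's theorem.  The diagonal case is trivial and the statement is
    symmetric, so only the increasing pairs of axes are treated. *)
Lemma partial_comm D f i j y :
  open D -> smooth D f -> D y -> pd i (pd j f) y = pd j (pd i f) y.
Proof.
  intros HD Hf.
  enough (W : forall i j, (i, j) = (Y1, Y2) \/ (i, j) = (Y1, Y3) \/ (i, j) = (Y2, Y3) ->
            D y -> pd i (pd j f) y = pd j (pd i f) y).
  { intros Hy; destruct i, j; first [reflexivity | apply W; [tauto|exact Hy]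
      | symmetry; apply W; [tauto|exact Hy]]. }
  clear i j; intros i j Hij Hy.
  assert (C2 := continuous_2d i j _ y
    (smooth_continuous D _ y (smooth_partial D _ i (smooth_partial D _ j Hf)) Hy)).
  assert (C1 := continuous_2d i j _ y
    (smooth_continuous D _ y (smooth_partial D _ j (smooth_partial D _ i Hf)) Hy)).
  assert (L := locally_2d_upd3 i j D y (HD y Hy)).
  assert (L' : locally_2d (fun s t =>
      let z := upd3 i s (upd3 j t y) in
      is_pd i f (pd i f z) z /\ is_pd j f (pd j f z) z
      /\ is_pd i (pd j f) (pd i (pd j f) z) z /\ is_pd j (pd i f) (pd j (pd i f) z) z)
    (coord3 i y) (coord3 j y)).
  { revert L; apply locally_2d_impl, locally_2d_forall; intros s t Hst z.
    split; [|split; [|split]]; apply (smooth_is_pd D _ _ z); try exact Hst;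
      try exact Hf; apply smooth_partial; exact Hf. }
  clear L.
  assert (L : locally_2d (fun s t =>
      let z := upd3 i s (upd3 j t y) in
      (ex_derive (fun r => f (upd3 i r z)) s /\ ex_derive (fun r => f (upd3 j r z)) t
       /\ ex_derive (fun r => pd j f (upd3 i r z)) s
       /\ ex_derive (fun r => pd i f (upd3 j r z)) t))
    (coord3 i y) (coord3 j y)).
  { revert L'; apply locally_2d_impl, locally_2d_forall; intros s t [H1 [H2 [H3 H4]]].
    destruct y as [[a b] c].
    destruct Hij as [E|[E|E]]; injection E as -> ->;
      (split; [|split; [|split]]); eexists;
      [exact H1|exact H2|exact H3|exact H4|exact H1|exact H2|exact H3|exact H4
      |exact H1|exact H2|exact H3|exact H4]. }
  destruct y as [[a b] c].
  destruct Hij as [E|[E|E]]; injection E as -> ->.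
  - exact (Schwarz (fun s t => f (s, t, c)) a b L C2 C1).
  - exact (Schwarz (fun s t => f (s, b, t)) a c L C2 C1).
  - exact (Schwarz (fun s t => f (a, s, t)) b c L C2 C1).
Qed.

Lemma smooth_plus D f g : open D -> smooth D f -> smooth D g -> smooth D (fun y => f y + g y).
Proof. intros HD Hf Hg; apply smooth_alg_smooth, alg_plus; try apply alg_smooth; assumption. Qed.

Lemma smooth_mult D f g : open D -> smooth D f -> smooth D g -> smooth D (fun y => f y * g y).
Proof. intros HD Hf Hg; apply smooth_alg_smooth, alg_mult; try apply alg_smooth; assumption. Qed.

Lemma smooth_const D k : open D -> smooth D (fun _ => k).
Proof. intros HD; apply smooth_alg_smooth, alg_const; assumption. Qed.

Lemma smooth_coord D i : open D -> smooth D (coord3 i).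
Proof. intros HD; apply smooth_alg_smooth, alg_coord; assumption. Qed.

Lemma smooth_scal D k f : open D -> smooth D f -> smooth D (fun y => k * f y).
Proof. intros HD Hf; apply smooth_mult; [|apply smooth_const|]; assumption. Qed.

(** * Potentials of closed forms with a parameter *)

Definition box (p : E3) (d : R) (y : E3) : Prop :=
  forall i, Rabs (coord3 i y - coord3 i p) < d.

Lemma open_box p d : open (box p d).
Proof.
  assert (H : forall i, open (fun y : E3 => Rabs (coord3 i y - coord3 i p) < d)).
  { intros i; apply (open_comp (coord3 i) (fun t => Rabs (t - coord3 i p) < d)).
    - intros y _; apply continuous_coord3.
    - apply (open_comp (fun t => Rabs (t - coord3 i p)) (fun t => t < d)); [|apply open_lt].
      intros t _; apply (continuous_comp (fun t => t - coord3 i p) Rabs).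
      + apply (continuous_minus (V := R_NormedModule) (fun t : R => t) (fun _ => coord3 i p));
          [apply continuous_id|apply continuous_const].
      + apply continuity_pt_filterlim, Rcontinuity_abs. }
  intros y Hy.
  generalize (filter_and _ _ (H Y1 y (Hy Y1)) (filter_and _ _ (H Y2 y (Hy Y2)) (H Y3 y (Hy Y3)))).
  apply filter_imp; intros z [H1 [H2 H3]] i; destruct i; assumption.
Qed.

Lemma locally_box (P : E3 -> Prop) p : locally p P -> exists d : posreal, forall y, box p d y -> P y.
Proof.
  intros [d Hd]; exists d; intros [[a' b'] c'] Hy; apply Hd; destruct p as [[a b] c].
  split; [split|]; [exact (Hy Y1)|exact (Hy Y2)|exact (Hy Y3)].
Qed.

Lemma box_center p (d : posreal) : box p d p.
Proof. intros i; unfold Rminus; rewrite Rplus_opp_r, Rabs_R0; apply cond_pos. Qed.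

Lemma between_close (a x t d : R) :
  Rabs (x - a) < d -> Rmin a x <= t <= Rmax a x -> Rabs (t - a) < d.
Proof.
  intros H1 H2; unfold Rabs in *; unfold Rmin, Rmax in H2.
  destruct (Rcase_abs (x - a)), (Rcase_abs (t - a)), (Rle_dec a x); lra.
Qed.

Lemma box_upd3 p d y i t :
  box p d y -> Rabs (t - coord3 i p) < d -> box p d (upd3 i t y).
Proof.
  intros Hy Ht j; generalize (Hy j); destruct y as [[a b] c], i, j; simpl; intros H;
    try exact H; exact Ht.
Qed.

Lemma continuous_line i (f : E3 -> R) y t :
  continuous f (upd3 i t y) -> continuous (fun s => f (upd3 i s y)) t.
Proof.
  intros H; apply (continuous_comp (fun s : R => upd3 i s y) f); [|exact H].
  apply filterlim_locally; intros e.
  exists e; intros s Hs; destruct y as [[a b] c], i; (split; [split|]); simpl;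
    first [exact Hs|apply ball_center].
Qed.

Lemma line_increment i (f g : E3 -> R) M (y : E3) t :
  (forall s, Rmin (coord3 i y) t <= s <= Rmax (coord3 i y) t ->
     is_pd i f (g (upd3 i s y)) (upd3 i s y) /\ Rabs (g (upd3 i s y)) <= M) ->
  Rabs (f (upd3 i t y) - f y) <= M * Rabs (t - coord3 i y).
Proof.
  intros H.
  assert (H' : forall s, Rmin (coord3 i y) t <= s <= Rmax (coord3 i y) t ->
     is_derive (fun r => f (upd3 i r y)) s (g (upd3 i s y))).
  { intros s Hs; generalize (proj1 (H s Hs)); destruct y as [[a b] c], i; exact (fun X => X). }
  destruct (MVT_gen (fun s => f (upd3 i s y)) (coord3 i y) t (fun s => g (upd3 i s y)))
    as [s [Hs E]].
  - intros s Hs; apply H'; lra.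
  - intros s Hs; apply continuity_pt_filterlim.
    apply (ex_derive_continuous (K := R_AbsRing) (V := R_NormedModule)).
    eexists; apply H', Hs.
  - rewrite upd3_coord3 in E; rewrite E, Rabs_mult.
    apply Rmult_le_compat_r; [apply Rabs_pos|apply H, Hs].
Qed.

(** Continuous, hence locally bounded, partial derivatives in two of the
    variables make [f] locally Lipschitz in them, uniformly in the third; in the
    third variable continuity along the single line through the point is enough,
    and this follows from differentiability.
    Joint continuity of a potential is thus obtained without estimates on the
    integrals that define it. *)
Lemma continuous_from_partials D f P Q R' :
  open D ->
  (forall y, D y -> continuous P y /\ is_pd Y1 f (P y) y) ->
  (forall y, D y -> continuous Q y /\ is_pd Y2 f (Q y) y) ->
  (forall y, D y -> is_pd Y3 f (R' y) y) ->
  forall y, D y -> continuous f y.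
Proof.
  intros HD H1 H2 H3 p Hp.
  set (M := Rabs (P p) + Rabs (Q p) + 1).
  assert (HM : 0 < M) by (unfold M; generalize (Rabs_pos (P p)) (Rabs_pos (Q p)); lra).
  assert (B : locally p (fun y => D y /\ Rabs (P y) <= M /\ Rabs (Q y) <= M)).
  { apply filter_and; [apply HD, Hp|].
    generalize (proj1 (filterlim_locally _ _) (proj1 (H1 p Hp)) (mkposreal 1 Rlt_0_1))
      (proj1 (filterlim_locally _ _) (proj1 (H2 p Hp)) (mkposreal 1 Rlt_0_1)).
    intros B1 B2; generalize (filter_and _ _ B1 B2); apply filter_imp.
    intros y [b1 b2]; change (Rabs (P y - P p) < 1) in b1; change (Rabs (Q y - Q p) < 1) in b2.
    generalize (Rabs_triang_inv (P y) (P p)) (Rabs_triang_inv (Q y) (Q p))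
      (Rabs_pos (P p)) (Rabs_pos (Q p)); unfold M; lra. }
  destruct (locally_box _ _ B) as [d Hd].
  assert (C : continuous (fun u => f (upd3 Y3 u p)) (coord3 Y3 p)).
  { apply (ex_derive_continuous (K := R_AbsRing) (V := R_NormedModule)).
    exists (R' p); exact (H3 p Hp). }
  apply filterlim_locally; intros e.
  assert (He : 0 < e / 3) by (generalize (cond_pos e); lra).
  destruct (proj1 (filterlim_locally _ _) C (mkposreal _ He)) as [d3 Hd3].
  rewrite upd3_coord3 in Hd3.
  assert (Hm : 0 < Rmin (Rmin d d3) (e / 3 / M)).
  { repeat apply Rmin_pos; try apply cond_pos; apply Rdiv_lt_0_compat; assumption. }
  set (m := Rmin (Rmin d d3) (e / 3 / M)) in *.
  assert (m <= d) by (unfold m; eapply Rle_trans; apply Rmin_l).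
  assert (m <= d3) by (unfold m; eapply Rle_trans; [apply Rmin_l|apply Rmin_r]).
  assert (Hmm : M * m <= e / 3).
  { apply Rle_trans with (M * (e / 3 / M)).
    - apply Rmult_le_compat_l; [lra|apply Rmin_r].
    - right; field; lra. }
  exists (mkposreal m Hm); intros y Hy.
  assert (Hb : forall i, Rabs (coord3 i y - coord3 i p) < m).
  { clear -Hy; destruct y as [[a' b'] c'], p as [[a b] c], Hy as [[Ha Hb'] Hc].
    intros i; destruct i; assumption. }
  clear Hy. 
  (* The path from [p] to [y] moves first along [Y3], then [Y2], then [Y1], so that
     the [Y3] step stays on the line through [p]. *)
  set (q := upd3 Y3 (coord3 Y3 y) p).
  set (r := upd3 Y2 (coord3 Y2 y) q).
  assert (Er : y = upd3 Y1 (coord3 Y1 y) r)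
    by (unfold r, q; destruct y as [[a' b'] c'], p as [[a b] c]; reflexivity).
  assert (E1 : coord3 Y1 r = coord3 Y1 p)
    by (unfold r, q; destruct y as [[a' b'] c'], p as [[a b] c]; reflexivity).
  assert (E2 : coord3 Y2 q = coord3 Y2 p)
    by (unfold q; destruct y as [[a' b'] c'], p as [[a b] c]; reflexivity).
  assert (Bq : box p d q).
  { apply box_upd3; [apply box_center|]. apply Rlt_le_trans with m; auto. }
  assert (Br : box p d r).
  { apply box_upd3; [exact Bq|]. apply Rlt_le_trans with m; auto. }
  assert (I1 : Rabs (f y - f r) <= M * Rabs (coord3 Y1 y - coord3 Y1 p)).
  { rewrite Er at 1; rewrite <- E1; apply (line_increment Y1 f P).
    intros s Hs; rewrite E1 in Hs.
    destruct (Hd (upd3 Y1 s r)) as [Ds [b _]]; [|split; [apply H1, Ds|exact b]].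
    apply box_upd3; [exact Br|].
    apply between_close with (2 := Hs), Rlt_le_trans with m; auto. }
  assert (I2 : Rabs (f r - f q) <= M * Rabs (coord3 Y2 y - coord3 Y2 p)).
  { unfold r; rewrite <- E2; apply (line_increment Y2 f Q).
    intros s Hs; rewrite E2 in Hs.
    destruct (Hd (upd3 Y2 s q)) as [Ds [_ b]]; [|split; [apply H2, Ds|exact b]].
    apply box_upd3; [exact Bq|].
    apply between_close with (2 := Hs), Rlt_le_trans with m; auto. }
  assert (I3 : Rabs (f q - f p) < e / 3).
  { apply Hd3; change (Rabs (coord3 Y3 y - coord3 Y3 p) < d3).
    apply Rlt_le_trans with m; auto. }
  change (Rabs (f y - f p) < e).
  assert (J1 : M * Rabs (coord3 Y1 y - coord3 Y1 p) <= M * m)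
    by (apply Rmult_le_compat_l; [lra|left; apply Hb]).
  assert (J2 : M * Rabs (coord3 Y2 y - coord3 Y2 p) <= M * m)
    by (apply Rmult_le_compat_l; [lra|left; apply Hb]).
  generalize (Rabs_triang (f y - f r) (f r - f p)) (Rabs_triang (f r - f q) (f q - f p)).
  replace (f y - f r + (f r - f p)) with (f y - f p) by ring.
  replace (f r - f q + (f q - f p)) with (f r - f p) by ring.
  lra.
Qed.

Definition primitive (p : E3) (i : axis3) (f : E3 -> R) (y : E3) : R :=
  RInt (fun s => f (upd3 i s y)) (coord3 i p) (coord3 i y).

Section Potential.

Variables (p : E3) (d : R).

Lemma box_segment i y s :
  box p d y -> Rmin (coord3 i p) (coord3 i y) <= s <= Rmax (coord3 i p) (coord3 i y) ->
  box p d (upd3 i s y).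
Proof. intros Hy Hs; apply box_upd3; [exact Hy|]; exact (between_close _ _ _ _ (Hy i) Hs). Qed.

Lemma ex_RInt_segment i f y :
  smooth (box p d) f -> box p d y ->
  ex_RInt (fun s => f (upd3 i s y)) (coord3 i p) (coord3 i y).
Proof.
  intros Hf Hy; apply (ex_RInt_continuous (V := R_CompleteNormedModule)); intros s Hs.
  apply continuous_line, (smooth_continuous (box p d)); [exact Hf|].
  apply box_segment; assumption.
Qed.

Lemma primitive_same_axis i f y :
  smooth (box p d) f -> box p d y -> is_pd i (primitive p i f) (f y) y.
Proof.
  intros Hf Hy; unfold is_pd.
  rewrite <- (upd3_coord3 i y) at 2.
  apply (is_derive_ext (fun t => RInt (fun s => f (upd3 i s y)) (coord3 i p) t)).
  { intros t; unfold primitive; destruct y as [[a b] c], i; reflexivity. }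
  apply (is_derive_RInt (V := R_NormedModule) (fun s => f (upd3 i s y)) _ (coord3 i p)).
  - generalize (locally_upd3 i _ y (open_box p d y Hy)); apply filter_imp; intros t Ht.
    apply (RInt_correct (V := R_CompleteNormedModule)).
    generalize (ex_RInt_segment i f _ Hf Ht).
    destruct y as [[a b] c], i; exact (fun X => X).
  - apply continuous_line; rewrite upd3_coord3.
    exact (smooth_continuous _ _ _ Hf Hy).
Qed.

(** Differentiation under the integral sign. *)
Lemma primitive_other_axis i j f y :
  i <> j -> smooth (box p d) f -> box p d y ->
  is_pd j (primitive p i f) (primitive p i (pd j f) y) y.
Proof.
  intros Hij Hf Hy.
  assert (H := is_derive_RInt_param (fun t s => f (upd3 i s (upd3 j t y)))
                 (coord3 i p) (coord3 i y) (coord3 j y)).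
  assert (Hn := locally_upd3 j _ y (open_box p d y Hy)).
  assert (Ec : forall t, coord3 i (upd3 j t y) = coord3 i y)
    by (intros t; destruct y as [[a b] c], i, j; first [reflexivity|congruence]).
  assert (H' : is_derive (fun t => RInt (fun s => f (upd3 i s (upd3 j t y)))
                                     (coord3 i p) (coord3 i y)) (coord3 j y)
           (RInt (fun s => Derive (fun t => f (upd3 i s (upd3 j t y))) (coord3 j y))
              (coord3 i p) (coord3 i y))).
  { apply H; clear H.
    - revert Hn; apply filter_imp; intros t Ht s Hs; rewrite <- (Ec t) in Hs.
      generalize (smooth_is_pd _ f j _ Hf (box_segment i _ s Ht Hs)).
      intros Hd; eexists; revert Hd.
      destruct y as [[a b] c], i, j; try congruence; exact (fun X => X).
    - intros s Hs.
      generalize (continuous_2d j i (pd j f) _ (smooth_continuous _ _ _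
        (smooth_partial _ _ j Hf) (box_segment i _ s Hy Hs))).
      destruct y as [[a b] c], i, j; try congruence; exact (fun X => X).
    - revert Hn; apply filter_imp; intros t Ht.
      generalize (ex_RInt_segment i f _ Hf Ht); rewrite Ec; exact (fun X => X). }
  revert H'; clear -Hij; unfold is_pd, primitive.
  destruct y as [[a b] c], i, j; try congruence; exact (fun X => X).
Qed.

Lemma primitive_partial i f y :
  smooth (box p d) f -> box p d y ->
  primitive p i (pd i f) y = f y - f (upd3 i (coord3 i p) y).
Proof.
  intros Hf Hy; unfold primitive.
  apply (is_RInt_unique (V := R_CompleteNormedModule)).
  replace (f y) with (f (upd3 i (coord3 i y) y)) by now rewrite upd3_coord3.
  apply (is_RInt_derive (V := R_CompleteNormedModule) (fun s => f (upd3 i s y))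
           (fun s => pd i f (upd3 i s y))).
  - intros s Hs; generalize (smooth_is_pd _ f i _ Hf (box_segment i y s Hy Hs)).
    destruct y as [[a b] c], i; exact (fun X => X).
  - intros s Hs; apply continuous_line, (smooth_continuous (box p d)).
    + apply smooth_partial, Hf.
    + apply box_segment; assumption.
Qed.

(** The line integral of [P dx^1 + Q dx^2] from the centre of the box along an
    [x^1]-segment followed by an [x^2]-segment. *)
Definition potential (P Q : E3 -> R) (y : E3) : R :=
  primitive p Y1 P (upd3 Y2 (coord3 Y2 p) y) + primitive p Y2 Q y.

Definition closed_pair (P Q : E3 -> R) : Prop :=
  smooth (box p d) P /\ smooth (box p d) Q /\
  forall y, box p d y -> pd Y2 P y = pd Y1 Q y.

Lemma box_base y : box p d y -> box p d (upd3 Y2 (coord3 Y2 p) y).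
Proof.
  intros Hy; apply box_upd3; [exact Hy|].
  apply between_close with (1 := Hy Y2); split; [apply Rmin_l|apply Rmax_l].
Qed.

(** The derivative of the second leg is the integral of [d_1 Q = d_2 P] along
    [x^2], which telescopes and turns the value of [P] at the corner of the path
    into its value at [y]. *)
Lemma potential_Y1 P Q y :
  closed_pair P Q -> box p d y -> is_pd Y1 (potential P Q) (P y) y.
Proof.
  intros [HP [HQ HPQ]] Hy.
  replace (P y) with (P (upd3 Y2 (coord3 Y2 p) y) + primitive p Y2 (pd Y1 Q) y).
  - apply (is_pd_plus Y1 (fun z => primitive p Y1 P (upd3 Y2 (coord3 Y2 p) z))).
    + generalize (primitive_same_axis Y1 P _ HP (box_base y Hy)).
      destruct y as [[a b] c]; exact (fun X => X).
    + apply primitive_other_axis; [discriminate|assumption..].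
  - replace (primitive p Y2 (pd Y1 Q) y) with (primitive p Y2 (pd Y2 P) y).
    + rewrite primitive_partial by assumption; ring.
    + apply (RInt_ext (V := R_CompleteNormedModule)); intros s Hs.
      apply HPQ, box_segment; [exact Hy|lra].
Qed.

Lemma potential_Y2 P Q y :
  closed_pair P Q -> box p d y -> is_pd Y2 (potential P Q) (Q y) y.
Proof.
  intros [HP [HQ HPQ]] Hy; rewrite <- (Rplus_0_l (Q y)).
  apply (is_pd_plus Y2 (fun z => primitive p Y1 P (upd3 Y2 (coord3 Y2 p) z))).
  - destruct y as [[a b] c]; exact (is_pd_const Y2 (primitive p Y1 P (a, coord3 Y2 p, c)) (a, b, c)).
  - apply primitive_same_axis; assumption.
Qed.

(** The parameter derivative of a potential is a potential, which is what makes
    the class of potentials closed under differentiation. *)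
Lemma potential_Y3 P Q y :
  closed_pair P Q -> box p d y ->
  is_pd Y3 (potential P Q) (potential (pd Y3 P) (pd Y3 Q) y) y.
Proof.
  intros [HP [HQ HPQ]] Hy.
  apply (is_pd_plus Y3 (fun z => primitive p Y1 P (upd3 Y2 (coord3 Y2 p) z))).
  - assert (H : Y1 <> Y3) by discriminate.
    generalize (primitive_other_axis Y1 Y3 P _ H HP (box_base y Hy)).
    destruct y as [[a b] c]; exact (fun X => X).
  - apply primitive_other_axis; [discriminate|assumption..].
Qed.

Lemma closed_pair_Y3 P Q : closed_pair P Q -> closed_pair (pd Y3 P) (pd Y3 Q).
Proof.
  intros [HP [HQ HPQ]]; split; [|split]; try (apply smooth_partial; assumption).
  intros y Hy; rewrite (partial_comm _ _ _ _ _ (open_box p d) HP Hy).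
  rewrite (partial_comm _ _ _ _ _ (open_box p d) HQ Hy).
  apply (partials_ext (box p d) _ _ (open_box p d) HPQ (Y3 :: nil) y Hy).
Qed.

Lemma smooth_potential P Q : closed_pair P Q -> smooth (box p d) (potential P Q).
Proof.
  intros H.
  apply (smooth_coind (box p d)
    (fun f => smooth (box p d) f \/ exists P Q, closed_pair P Q /\ f = potential P Q)
    (open_box p d)); [| |right; exists P, Q; tauto]; clear P Q H;
  intros f [Hf|[P [Q [H ->]]]].
  - intros y Hy; exact (smooth_continuous _ _ _ Hf Hy).
  - destruct (H) as [HP [HQ _]].
    apply (continuous_from_partials _ _ P Q (potential (pd Y3 P) (pd Y3 Q)) (open_box p d)).
    + split; [apply (smooth_continuous (box p d))|apply potential_Y1]; assumption.
    + split; [apply (smooth_continuous (box p d))|apply potential_Y2]; assumption.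
    + intros; apply potential_Y3; assumption.
  - intros i; exists (pd i f); split; [left; apply smooth_partial, Hf|].
    intros y Hy; apply (smooth_is_pd (box p d)); assumption.
  - destruct (H) as [HP [HQ _]]; intros [| |].
    + exists P; split; [left; exact HP|intros; apply potential_Y1; assumption].
    + exists Q; split; [left; exact HQ|intros; apply potential_Y2; assumption].
    + exists (potential (pd Y3 P) (pd Y3 Q)); split.
      * right; exists (pd Y3 P), (pd Y3 Q); split; [apply closed_pair_Y3, H|reflexivity].
      * intros; apply potential_Y3; assumption.
Qed.

Lemma poincare P Q :
  closed_pair P Q ->
  exists A, smooth (box p d) A /\
    forall y, box p d y -> pd Y1 A y = P y /\ pd Y2 A y = Q y.
Proof.
  intros H; exists (potential P Q); split; [apply smooth_potential, H|].
  intros y Hy; split; apply is_pd_unique; [apply potential_Y1|apply potential_Y2]; assumption.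
Qed.

End Potential.

(** * Biharmonic functions and Goursat's representation *)

Lemma partial_scal i k f y : pd i (fun z => k * f z) y = k * pd i f y.
Proof. unfold partial; apply Derive_scal. Qed.

Lemma partial_ext D f g i y :
  open D -> (forall z, D z -> f z = g z) -> D y -> pd i f y = pd i g y.
Proof. intros HD Hfg Hy; exact (partials_ext D f g HD Hfg (i :: nil) y Hy). Qed.

Lemma partial_plus D f g i y :
  smooth D f -> smooth D g -> D y -> pd i (fun z => f z + g z) y = pd i f y + pd i g y.
Proof.
  intros Hf Hg Hy; apply is_pd_unique, is_pd_plus; apply (smooth_is_pd D); assumption.
Qed.

Lemma lap_ext D f g y :
  open D -> (forall z, D z -> f z = g z) -> D y -> lap f y = lap g y.
Proof.
  intros HD Hfg Hy; exact (f_equal2 Rplus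
    (partials_ext D f g HD Hfg (Y1 :: Y1 :: nil) y Hy)
    (partials_ext D f g HD Hfg (Y2 :: Y2 :: nil) y Hy)).
Qed.

Lemma smooth_lap D f : open D -> smooth D f -> smooth D (lap f).
Proof.
  intros HD Hf; apply smooth_plus; [exact HD|..]; apply smooth_partial, smooth_partial, Hf.
Qed.

Lemma partial2_plus D f g i y :
  open D -> smooth D f -> smooth D g -> D y ->
  pd i (pd i (fun z => f z + g z)) y = pd i (pd i f) y + pd i (pd i g) y.
Proof.
  intros HD Hf Hg Hy.
  rewrite (partial_ext D _ (fun z => pd i f z + pd i g z) i y HD); [|intros z Hz|exact Hy].
  - apply (partial_plus D); [apply smooth_partial..|]; assumption.
  - apply (partial_plus D); assumption.
Qed.

Lemma lap_plus D f g y :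
  open D -> smooth D f -> smooth D g -> D y -> lap (fun z => f z + g z) y = lap f y + lap g y.
Proof.
  intros HD Hf Hg Hy; unfold lap; rewrite !(partial2_plus D) by assumption; ring.
Qed.

Lemma lap_scal k f y : lap (fun z => k * f z) y = k * lap f y.
Proof.
  unfold lap.
  assert (E : forall i, pd i (fun z => k * f z) = fun z => k * pd i f z)
    by (intros i; apply functional_extensionality; intros z; apply partial_scal).
  rewrite !E, !partial_scal; ring.
Qed.

Lemma lap_coord_mult D i f y :
  open D -> smooth D f -> D y -> i <> Y3 ->
  lap (fun z => coord3 i z * f z) y = 2 * pd i f y + coord3 i y * lap f y.
Proof.
  intros HD Hf Hy Hi.
  assert (E : forall j z, D z -> pd j (fun w => coord3 i w * f w) z
            = (match j, i with Y1, Y1 | Y2, Y2 | Y3, Y3 => 1 | _, _ => 0 end) * f z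
              + coord3 i z * pd j f z).
  { intros j z Hz; apply is_pd_unique, is_pd_mult; [apply is_pd_coord|].
    apply (smooth_is_pd D); assumption. }
  assert (E2 : forall j, pd j (pd j (fun w => coord3 i w * f w)) y
            = 2 * (match j, i with Y1, Y1 | Y2, Y2 | Y3, Y3 => 1 | _, _ => 0 end) * pd j f y
              + coord3 i y * pd j (pd j f) y).
  { intros j; rewrite (partial_ext D _ _ j y HD (E j) Hy).
    set (k := match j, i with Y1, Y1 | Y2, Y2 | Y3, Y3 => 1 | _, _ => 0 end).
    transitivity (k * pd j f y + (k * pd j f y + coord3 i y * pd j (pd j f) y)); [|ring].
    apply is_pd_unique, is_pd_plus.
    - apply (is_derive_scal (fun t => f (upd3 j t y))).
      apply (smooth_is_pd D); assumption.
    - apply is_pd_mult; [apply is_pd_coord|].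
      apply (smooth_is_pd D); [apply smooth_partial|]; assumption. }
  unfold lap; rewrite !E2; destruct i; simpl; [ring|ring|congruence].
Qed.

Definition cauchy_riemann (D : E3 -> Prop) (A B : E3 -> R) : Prop :=
  forall y, D y -> pd Y1 A y = pd Y2 B y /\ pd Y2 A y = - pd Y1 B y.

(** Multiplication of [A + i B] by [- i]; it transfers statements on the real
    part to the imaginary part. *)
Lemma cauchy_riemann_rotate D A B :
  cauchy_riemann D A B -> cauchy_riemann D B (fun y => -1 * A y).
Proof. intros H y Hy; destruct (H y Hy) as [H1 H2]; rewrite !partial_scal; lra. Qed.

Lemma cauchy_riemann_harmonic D A B y :
  open D -> smooth D B -> cauchy_riemann D A B -> D y -> lap A y = 0.
Proof.
  intros HD HB H Hy; unfold lap.
  rewrite (partial_ext D _ (pd Y2 B) Y1 y HD); [|intros z Hz; apply (H z Hz)|exact Hy].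
  rewrite (partial_ext D _ (fun z => -1 * pd Y1 B z) Y2 y HD); [| |exact Hy].
  - rewrite partial_scal, (partial_comm D B Y1 Y2 y HD HB Hy); ring.
  - intros z Hz; rewrite (proj2 (H z Hz)); ring.
Qed.

(** The complex derivative of a holomorphic function is holomorphic. *)
Lemma cauchy_riemann_partial D A B :
  open D -> smooth D A -> smooth D B -> cauchy_riemann D A B ->
  cauchy_riemann D (pd Y1 A) (pd Y1 B).
Proof.
  intros HD HA HB H y Hy; split.
  - rewrite <- (partial_comm D B Y1 Y2 y HD HB Hy).
    apply (partial_ext D); [exact HD|intros z Hz; apply (H z Hz)|exact Hy].
  - rewrite <- (partial_comm D A Y1 Y2 y HD HA Hy).
    rewrite (partial_ext D _ (fun z => -1 * pd Y1 B z) Y1 y HD); [| |exact Hy].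
    + rewrite partial_scal; ring.
    + intros z Hz; rewrite (proj2 (H z Hz)); ring.
Qed.

(** This is [2 Re (zbar (A + i B) + beta)] with [Re beta = c], in the coordinates
    [(x^1, x^2)] instead of [z]: the factor is [2 / sqrt 2 = sqrt 2]. *)
Definition goursat (A B c : E3 -> R) (y : E3) : R :=
  sqrt 2 * (coord3 Y1 y * A y + coord3 Y2 y * B y) + 2 * c y.

(** As [A] and [B] are harmonic, only the cross terms
    [2 sqrt 2 (d_1 A + d_2 B)] of the Laplacian of the products remain, and they
    are equal. *)
Lemma lap_goursat D A B c y :
  open D -> smooth D A -> smooth D B -> smooth D c -> cauchy_riemann D A B -> D y ->
  lap (goursat A B c) y = 4 * sqrt 2 * pd Y1 A y + 2 * lap c y.
Proof.
  intros HD HA HB Hc H Hy.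
  assert (SA : smooth D (fun z => coord3 Y1 z * A z))
    by (apply smooth_mult; [|apply smooth_coord|]; assumption).
  assert (SB : smooth D (fun z => coord3 Y2 z * B z))
    by (apply smooth_mult; [|apply smooth_coord|]; assumption).
  unfold goursat; rewrite (lap_plus D _ _ y HD); [| | |exact Hy].
  - rewrite !lap_scal, (lap_plus D) by assumption.
    rewrite !(lap_coord_mult D) by (assumption || discriminate).
    rewrite (cauchy_riemann_harmonic D A B y HD HB H Hy).
    rewrite (cauchy_riemann_harmonic D B (fun z => -1 * A z) y HD);
      [|apply smooth_scal; assumption|apply cauchy_riemann_rotate, H|exact Hy].
    rewrite (proj1 (H y Hy)); ring.
  - apply smooth_scal; [exact HD|]; apply smooth_plus; assumption.
  - apply smooth_scal; assumption.
Qed.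

Lemma biharmonic_goursat D A B c e y :
  open D -> smooth D A -> smooth D B -> smooth D c -> smooth D e ->
  cauchy_riemann D A B -> cauchy_riemann D c e -> D y ->
  lap (lap (goursat A B c)) y = 0.
Proof.
  intros HD HA HB Hc He H1 H2 Hy.
  rewrite (lap_ext D _ (fun z => 4 * sqrt 2 * pd Y1 A z) y HD); [| |exact Hy].
  - rewrite lap_scal, (cauchy_riemann_harmonic D (pd Y1 A) (pd Y1 B) y HD); [ring| | |exact Hy].
    + apply smooth_partial, HB.
    + apply cauchy_riemann_partial; assumption.
  - intros z Hz; rewrite (lap_goursat D) by assumption.
    rewrite (cauchy_riemann_harmonic D c e z) by assumption; ring.
Qed.

(** The form [- d_2 k dx^1 + d_1 k dx^2] is closed exactly when [k] is
    harmonic. *)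
Lemma harmonic_conjugate p d k :
  smooth (box p d) k -> (forall y, box p d y -> lap k y = 0) ->
  exists l, smooth (box p d) l /\ cauchy_riemann (box p d) k l.
Proof.
  intros Hk Hl.
  destruct (poincare p d (fun y => -1 * pd Y2 k y) (pd Y1 k)) as [l [Sl El]].
  - split; [|split].
    + apply smooth_scal; [apply open_box|apply smooth_partial, Hk].
    + apply smooth_partial, Hk.
    + intros y Hy; rewrite partial_scal; generalize (Hl y Hy); unfold lap; lra.
  - exists l; split; [exact Sl|]; intros y Hy; destruct (El y Hy); lra.
Qed.

(** The real and imaginary parts of [(k + i l) (dx^1 + i dx^2)] are closed by the
    Cauchy-Riemann equations; their potentials are [A] and [B]. *)
Lemma holomorphic_primitive p d k l :
  smooth (box p d) k -> smooth (box p d) l -> cauchy_riemann (box p d) k l ->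
  exists A B, smooth (box p d) A /\ smooth (box p d) B /\
    cauchy_riemann (box p d) A B /\ forall y, box p d y -> pd Y1 A y = k y.
Proof.
  intros Hk Hl H.
  destruct (poincare p d k (fun y => -1 * l y)) as [A [SA EA]].
  - split; [exact Hk|split].
    + apply smooth_scal; [apply open_box|exact Hl].
    + intros y Hy; rewrite partial_scal, (proj2 (H y Hy)); ring.
  - destruct (poincare p d l k) as [B [SB EB]].
    + split; [exact Hl|split; [exact Hk|]].
      intros y Hy; symmetry; apply (H y Hy).
    + exists A, B; split; [exact SA|split; [exact SB|split]].
      * intros y Hy; destruct (EA y Hy), (EB y Hy); lra.
      * intros y Hy; apply (EA y Hy).
Qed.

Lemma sqrt2_neq : sqrt 2 <> 0.
Proof. apply Rgt_not_eq, sqrt_lt_R0; lra. Qed.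

Lemma goursat_exists p d h :
  smooth (box p d) h -> (forall y, box p d y -> lap (lap h) y = 0) ->
  exists A B c e,
    smooth (box p d) A /\ smooth (box p d) B /\ smooth (box p d) c /\ smooth (box p d) e /\
    cauchy_riemann (box p d) A B /\ cauchy_riemann (box p d) c e /\
    forall y, box p d y -> h y = goursat A B c y.
Proof.
  intros Hh Hb.
  assert (HD := open_box p d).
  (* [lap_goursat] forces [d_1 A] to be this multiple of [lap h]. *)
  set (k := fun y => / (4 * sqrt 2) * lap h y).
  assert (Sk : smooth (box p d) k) by (apply smooth_scal, smooth_lap; assumption).
  destruct (harmonic_conjugate p d k Sk) as [l [Sl Hkl]].
  { intros y Hy; unfold k; rewrite lap_scal, Hb by exact Hy; ring. }
  destruct (holomorphic_primitive p d k l Sk Sl Hkl) as [A [B [SA [SB [HAB HA]]]]].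
  set (g := goursat A B (fun _ => 0)).
  assert (Sg : smooth (box p d) g).
  { unfold g, goursat; apply smooth_plus; [exact HD| |].
    - apply smooth_scal; [exact HD|].
      apply smooth_plus; [exact HD|..]; (apply smooth_mult; [exact HD|apply smooth_coord, HD|]);
        assumption.
    - apply smooth_scal, smooth_const; assumption. }
  set (c := fun y => / 2 * (h y + -1 * g y)).
  assert (Sc : smooth (box p d) c).
  { apply smooth_scal, smooth_plus; [..|apply smooth_scal]; assumption. }
  destruct (harmonic_conjugate p d c Sc) as [e [Se Hce]].
  { intros y Hy; unfold c.
    rewrite lap_scal, (lap_plus (box p d)), lap_scal; try assumption;
      [|apply smooth_scal; assumption].
    unfold g; rewrite (lap_goursat (box p d)); try assumption; [|apply smooth_const, HD].
    rewrite HA by exact Hy.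
    replace (lap (fun _ => 0) y) with (0 * lap (fun _ => 0) y)
      by (rewrite <- lap_scal; f_equal; apply functional_extensionality; intros; ring).
    unfold k; field; exact sqrt2_neq. }
  exists A, B, c, e; repeat (split; [assumption|]).
  intros y Hy; unfold c, g, goursat; field.
Qed.

(** * Complex derivatives and the Cauchy-Riemann equations *)

(** Unfolds [is_derive] in a way that treats the real and the complex field
    alike. *)
Lemma is_derive_iff (K : AbsRing) (V : NormedModule K) (f : K -> V) (x : K) (l : V) :
  is_derive f x l <->
  forall eps : posreal, locally x (fun y =>
    norm (minus (minus (f y) (f x)) (scal (minus y x) l)) <= eps * norm (minus y x)).
Proof.
  split.
  - intros [_ H]; apply (H x); intros P HP; exact HP.
  - intros H; split; [apply is_linear_scal_l|].
    intros z Hz; rewrite <- (is_filter_lim_locally_unique _ _ Hz); exact H.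
Qed.

Lemma is_C_derive_iff (f : C -> C) (z l : C) :
  is_derive (K := C_AbsRing) (V := C_NormedModule) f z l <->
  forall eps : posreal, exists delta : posreal, forall w : C,
    Cmod (w - z) < delta -> Cmod (f w - f z - (w - z) * l) <= eps * Cmod (w - z).
Proof. exact (is_derive_iff C_AbsRing C_NormedModule f z l). Qed.

Lemma is_R_derive_iff (f : R -> R) (x l : R) :
  is_derive f x l <->
  forall eps : posreal, exists delta : posreal, forall y : R,
    Rabs (y - x) < delta -> Rabs (f y - f x - (y - x) * l) <= eps * Rabs (y - x).
Proof. exact (is_derive_iff R_AbsRing R_NormedModule f x l). Qed.

Lemma Cmod_Re_le (z : C) : Rabs (fst z) <= Cmod z.
Proof. eapply Rle_trans; [apply Rmax_l|apply Rmax_Cmod]. Qed.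
Lemma Cmod_Im_le (z : C) : Rabs (snd z) <= Cmod z.
Proof. eapply Rle_trans; [apply Rmax_r|apply Rmax_Cmod]. Qed.

(** Restricting a complex derivative to the real lines in the directions [1] and
    [i] gives the partial derivatives of the real and imaginary parts. *)
Lemma is_C_derive_line (f : C -> C) (z l v : C) :
  Cmod v = 1 ->
  is_derive (K := C_AbsRing) (V := C_NormedModule) f z l ->
  is_derive (fun t : R => fst (f (z + RtoC t * v)%C)) 0 (fst (v * l)%C) /\
  is_derive (fun t : R => snd (f (z + RtoC t * v)%C)) 0 (snd (v * l)%C).
Proof.
  intros Hv H; rewrite is_C_derive_iff in H.
  assert (K : forall eps : posreal, exists delta : posreal, forall t : R,
    Rabs (t - 0) < delta ->
    Cmod (f (z + RtoC t * v)%C - f (z + RtoC 0 * v)%C - RtoC (t - 0) * (v * l))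
      <= eps * Rabs (t - 0)).
  { intros eps; destruct (H eps) as [delta Hd]; exists delta; intros t Ht.
    assert (E : (z + RtoC t * v - z)%C = (RtoC t * v)%C) by ring.
    assert (Em : Cmod (z + RtoC t * v - z) = Rabs (t - 0))
      by now rewrite E, Cmod_mult, Hv, Cmod_R, Rmult_1_r, Rminus_0_r.
    generalize (Hd (z + RtoC t * v)%C); rewrite Em; intros X; specialize (X Ht).
    replace (z + RtoC 0 * v)%C with z by ring.
    rewrite E in X; rewrite Rminus_0_r in X |- *.
    replace (RtoC t * (v * l))%C with (RtoC t * v * l)%C by ring; exact X. }
  split; apply is_R_derive_iff; intros eps; destruct (K eps) as [delta Hd];
    exists delta; intros t Ht; (eapply Rle_trans; [|exact (Hd t Ht)]).
  - eapply Rle_trans; [|apply Cmod_Re_le]; right; f_equal; simpl; ring.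
  - eapply Rle_trans; [|apply Cmod_Im_le]; right; f_equal; simpl; ring.
Qed.

Lemma is_derive_shift (g : R -> R) (a l : R) :
  is_derive (fun t => g (a + t)) 0 l -> is_derive g a l.
Proof.
  intros H; apply (is_derive_ext (fun t => g (a + (t - a)))).
  { intros t; f_equal; ring. }
  rewrite <- (Rmult_1_l l).
  apply (is_derive_comp (V := R_NormedModule) (fun t => g (a + t)) (fun t => t - a)).
  - unfold Rminus; rewrite Rplus_opp_r; exact H.
  - auto_derive; [exact I|ring].
Qed.

Lemma holomorphic_cauchy_riemann (O : C * R -> Prop) (f : C * R -> C) :
  holomorphic_in_z_on O f ->
  cauchy_riemann O (fun q => Re (f q)) (fun q => Im (f q)).
Proof.
  intros H [[x y] u] Hq; destruct (H (x, y) u Hq) as [l Hl].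
  destruct (is_C_derive_line _ _ _ 1%C Cmod_1 Hl) as [H1 H2].
  destruct (is_C_derive_line _ _ _ Ci (Cmod_Ci) Hl) as [H3 H4].
  assert (V1 : forall t : R, ((x, y) + RtoC t * 1)%C = (x + t, y)).
  { intros t; apply injective_projections; simpl; ring. }
  assert (V2 : forall t : R, ((x, y) + RtoC t * Ci)%C = (x, y + t)).
  { intros t; apply injective_projections; simpl; ring. }
  assert (E1 : is_pd Y1 (fun q => Re (f q)) (fst l) (x, y, u)).
  { apply (is_derive_shift (fun t => Re (f (t, y, u)))).
    replace (fst l) with (fst (1 * l)%C) by (simpl; ring).
    revert H1; apply is_derive_ext; intros t.
    rewrite V1; reflexivity. }
  assert (E2 : is_pd Y1 (fun q => Im (f q)) (snd l) (x, y, u)).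
  { apply (is_derive_shift (fun t => Im (f (t, y, u)))).
    replace (snd l) with (snd (1 * l)%C) by (simpl; ring).
    revert H2; apply is_derive_ext; intros t.
    rewrite V1; reflexivity. }
  assert (E3' : is_pd Y2 (fun q => Re (f q)) (- snd l) (x, y, u)).
  { apply (is_derive_shift (fun t => Re (f (x, t, u)))).
    replace (- snd l) with (fst (Ci * l)%C) by (simpl; ring).
    revert H3; apply is_derive_ext; intros t.
    rewrite V2; reflexivity. }
  assert (E4' : is_pd Y2 (fun q => Im (f q)) (fst l) (x, y, u)).
  { apply (is_derive_shift (fun t => Im (f (x, t, u)))).
    replace (fst l) with (snd (Ci * l)%C) by (simpl; ring).
    revert H4; apply is_derive_ext; intros t.
    rewrite V2; reflexivity. }
  apply is_pd_unique in E1, E2, E3', E4'; split.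
  - exact (eq_trans E1 (eq_sym E4')).
  - exact (eq_trans E3' (f_equal Ropp (eq_sym E2))).
Qed.

(** Continuous partial derivatives give total differentiability in [(x, y)] for
    fixed [u], from which a complex derivative can be assembled. *)
Lemma smooth_differentiable D f x y u :
  open D -> smooth D f -> D (x, y, u) ->
  differentiable_pt_lim (fun s t => f (s, t, u)) x y (pd Y1 f (x, y, u)) (pd Y2 f (x, y, u)).
Proof.
  intros HD Hf Hq; apply filterdiff_differentiable_pt_lim.
  apply (is_derive_filterdiff (fun s t => f (s, t, u)) x y (fun s t => pd Y1 f (s, t, u))).
  - assert (L := proj1 (locally_2d_locally _ _ _) (locally_2d_upd3 Y1 Y2 D _ (HD _ Hq))).
    revert L; apply filter_imp; intros [s t] Hst; exact (smooth_is_pd D f Y1 _ Hf Hst).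
  - exact (smooth_is_pd D f Y2 _ Hf Hq).
  - exact (proj1 (continuity_2d_pt_filterlim _ _ _) (continuous_2d Y1 Y2 _ _
      (smooth_continuous D _ _ (smooth_partial D f Y1 Hf) Hq))).
Qed.

Lemma Cmod_increment_le (A0 A1 B0 B1 a b x x' y y' e : R) :
  Rabs (A1 - A0 - (a * (x' - x) + - b * (y' - y))) <= e ->
  Rabs (B1 - B0 - (b * (x' - x) + a * (y' - y))) <= e ->
  Cmod ((A1, B1) - (A0, B0) - ((x', y') - (x, y)) * (a, b)) <= 2 * e.
Proof.
  intros H1 H2; set (w := ((A1, B1) - (A0, B0) - ((x', y') - (x, y)) * (a, b))%C).
  assert (W : Cmod w <= Rabs (fst w) + Rabs (snd w)).
  { apply Rle_trans with (Cmod (RtoC (fst w) + Ci * RtoC (snd w))).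
    - right; f_equal; apply injective_projections; simpl; ring.
    - eapply Rle_trans; [apply Cmod_triangle|].
      rewrite Cmod_mult, Cmod_Ci, !Cmod_R; right; ring. }
  replace (A1 - A0 - _) with (fst w) in H1 by (unfold w; simpl; ring).
  replace (B1 - B0 - _) with (snd w) in H2 by (unfold w; simpl; ring).
  lra.
Qed.

Lemma cauchy_riemann_holomorphic (O : C * R -> Prop) (A B : C * R -> R) :
  open (T := E3) O -> smooth O A -> smooth O B -> cauchy_riemann O A B ->
  holomorphic_in_z_on O (fun q => (A q, B q)).
Proof.
  intros HO HA HB H [x y] u Hq.
  exists (pd Y1 A (x, y, u), pd Y1 B (x, y, u)); apply is_C_derive_iff; intros eps.
  assert (He : 0 < eps / 2) by (generalize (cond_pos eps); lra).
  destruct (smooth_differentiable O A x y u HO HA Hq (mkposreal _ He)) as [d1 H1].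
  destruct (smooth_differentiable O B x y u HO HB Hq (mkposreal _ He)) as [d2 H2].
  destruct (H _ Hq) as [R1 R2].
  exists (mkposreal _ (Rmin_pos _ _ (cond_pos d1) (cond_pos d2))).
  intros [x' y'] Hw; simpl pos in *.
  assert (Hx := Cmod_Re_le ((x', y') - (x, y))%C).
  assert (Hy := Cmod_Im_le ((x', y') - (x, y))%C).
  change (Rabs (x' - x) <= Cmod ((x', y') - (x, y))%C) in Hx.
  change (Rabs (y' - y) <= Cmod ((x', y') - (x, y))%C) in Hy.
  set (m := Cmod ((x', y') - (x, y))%C) in *.
  assert (Hm1 := Rmin_l d1 d2); assert (Hm2 := Rmin_r d1 d2).
  assert (Hmm : eps / 2 * Rmax (Rabs (x' - x)) (Rabs (y' - y)) <= eps / 2 * m)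
    by (apply Rmult_le_compat_l; [lra|apply Rmax_lub; assumption]).
  apply Rle_trans with (2 * (eps / 2 * Rmax (Rabs (x' - x)) (Rabs (y' - y)))); [|lra].
  apply Cmod_increment_le.
  - replace (- pd Y1 B (x, y, u)) with (pd Y2 A (x, y, u)) by exact R2.
    apply (H1 x' y'); lra.
  - replace (pd Y1 A (x, y, u)) with (pd Y2 B (x, y, u)) by (symmetry; exact R1).
    apply (H2 x' y'); lra.
Qed.

(** * The normal form *)

Lemma cauchy_riemann_scale r D A B :
  smooth D A -> smooth D B -> cauchy_riemann D A B ->
  cauchy_riemann (fun y => D (scale3 r y)) (fun y => A (scale3 r y)) (fun y => B (scale3 r y)).
Proof.
  intros HA HB H y Hy.
  assert (E : forall f i, smooth D f ->
            pd i (fun z => f (scale3 r z)) y = scale_factor r i * pd i f (scale3 r y)).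
  { intros f i Hf; apply is_pd_unique, is_pd_scale, (smooth_is_pd D); assumption. }
  rewrite !E by assumption; destruct (H _ Hy) as [H1 H2]; simpl.
  split; [rewrite H1|rewrite H2]; ring.
Qed.

Lemma bach_flat_iff M h :
  bach_flat_on M (pp_wave h) <-> forall p, M p -> lap (lap h) (xxu p) = 0.
Proof.
  split; intros H p Hp.
  - generalize (H p Hp U U); rewrite pp_bach; simpl; lra.
  - intros a b; rewrite pp_bach; destruct a, b; simpl; try reflexivity.
    rewrite H by exact Hp; ring.
Qed.

Lemma open_image M : open M -> open (fun y : E3 => exists q : E4, M q /\ xxu q = y).
Proof.
  intros HM y [[y' r] [Hq E]]; simpl in E; subst y'.
  destruct (HM _ Hq) as [e He]; exists e; intros z Hz; exists (z, r); split; [|reflexivity].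
  apply He; split; [exact Hz|apply ball_center].
Qed.

Lemma continuous_xxu p : continuous xxu p.
Proof.
  apply filterlim_locally; intros e; exists e; intros q Hq; apply Hq.
Qed.

Lemma div_sqrt2 x : x / sqrt 2 = / sqrt 2 * x.
Proof. apply Rmult_comm. Qed.

Lemma scale3_zu p : scale3 (sqrt 2) (zu p) = xxu p.
Proof.
  destruct p as [[[x1 x2] u] r]; unfold xxu, zu, zeta; simpl.
  f_equal; f_equal; field; apply sqrt2_neq.
Qed.

Lemma zu_scale3 p : zu p = scale3 (/ sqrt 2) (xxu p).
Proof.
  destruct p as [[[x1 x2] u] r]; unfold xxu, zu, zeta; simpl.
  rewrite !div_sqrt2; reflexivity.
Qed.

(** The expression is real, and [2 dz dzbar] is [(dx^1)^2 + (dx^2)^2] because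
    [2 / (sqrt 2)^2 = 1]. *)
Lemma normal_form_goursat alpha beta q v :
  normal_form alpha beta q v =
  RtoC (coord4 X1 v ^ 2 + coord4 X2 v ^ 2 + 2 * coord4 U v * (coord4 Rr v +
    goursat (fun y => Re (alpha (scale3 (/ sqrt 2) y))) (fun y => Im (alpha (scale3 (/ sqrt 2) y)))
            (fun y => Re (beta (scale3 (/ sqrt 2) y))) (xxu q) * coord4 U v)).
Proof.
  unfold normal_form, goursat; rewrite <- zu_scale3.
  generalize (alpha (zu q)) (beta (zu q)); intros [a1 a2] [b1 b2].
  destruct q as [[[x1 x2] u] r], v as [[[v1 v2] vu] vr]; unfold zeta; simpl.
  assert (E : sqrt 2 = 2 * / sqrt 2).
  { assert (S := sqrt_sqrt 2 ltac:(lra)); field_simplify_eq; [|apply sqrt2_neq]. simpl; lra. }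
  assert (E2 : / sqrt 2 * / sqrt 2 = / 2).
  { rewrite <- Rinv_mult, sqrt_sqrt by lra; reflexivity. }
  unfold Rdiv; set (s := / sqrt 2) in *; rewrite E.
  apply injective_projections; simpl; [|ring].
  apply Rminus_diag_uniq; transitivity ((s * s - / 2) * (2 * (v1 * v1 + v2 * v2))); [field|].
  rewrite E2; ring.
Qed.

(** Evaluating on the tangent vector [d_u] isolates the coefficient of
    [du^2]. *)
Lemma quadratic_normal_form_iff alpha beta h q :
  (forall v, RtoC (quadratic (pp_wave h) q v) = normal_form alpha beta q v) <->
  h (xxu q) = goursat (fun y => Re (alpha (scale3 (/ sqrt 2) y)))
                (fun y => Im (alpha (scale3 (/ sqrt 2) y)))
                (fun y => Re (beta (scale3 (/ sqrt 2) y))) (xxu q).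
Proof.
  split.
  - intros H; generalize (H (0, 0, 1, 0)).
    rewrite normal_form_goursat, pp_wave_quadratic; simpl; intros E.
    apply RtoC_inj in E; lra.
  - intros H [[[v1 v2] vu] vr].
    rewrite normal_form_goursat, pp_wave_quadratic, H; reflexivity.
Qed.

Lemma scale3_inv r s y : r * s = 1 -> scale3 r (scale3 s y) = y.
Proof.
  intros E; destruct y as [[a b] u]; simpl; rewrite <- !Rmult_assoc, E, !Rmult_1_l; reflexivity.
Qed.

(* M is the coordinate domain of the pp-wave; h only needs to be defined (and
   smooth) on the image of M under (x1, x2, u, r) |-> (x1, x2, u). *)
Theorem proposition2 (M : E4 -> Prop) (h : E3 -> R)
  (HM : open M)
  (Hh : smooth_on (fun y : E3 => exists q : E4, M q /\ xxu q = y) h) :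
  bach_flat_on M (pp_wave h) <-> locally_normal_form M (pp_wave h).
Proof.
  rewrite bach_flat_iff; split.
  - intros Hb p Hp.
    destruct (locally_box _ (xxu p) (open_image M HM _ (ex_intro _ p (conj Hp eq_refl))))
      as [d Hd].
    destruct (goursat_exists (xxu p) d h) as
      [A [B [c [e [SA [SB [Sc [Se [HAB [Hce E]]]]]]]]]].
    { exact (smooth_sub _ _ _ Hd Hh). }
    { intros y Hy; destruct (Hd y Hy) as [q [Hq <-]]; apply Hb, Hq. }
    assert (HO := open_scale3 (sqrt 2) _ (open_box (xxu p) d)).
    assert (SS : forall f, smooth (box (xxu p) d) f -> smooth _ (fun y => f (scale3 (sqrt 2) y)))
      by (intros f; apply smooth_scale, open_box).
    exists (fun q => M q /\ box (xxu p) d (xxu q)), 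
      (fun y => box (xxu p) d (scale3 (sqrt 2) y)),
      (fun y => (A (scale3 (sqrt 2) y), B (scale3 (sqrt 2) y))),
      (fun y => (c (scale3 (sqrt 2) y), e (scale3 (sqrt 2) y))).
    split; [|split; [|split; [|split; [|split; [|split; [|split; [|split; [|split]]]]]]]].
    + apply open_and; [exact HM|].
      apply (open_comp xxu); [intros q _; apply continuous_xxu|apply open_box].
    + split; [exact Hp|apply box_center].
    + intros q Hq; apply Hq.
    + exact HO.
    + intros q [_ Hq]; rewrite scale3_zu; exact Hq.
    + split; apply SS; assumption.
    + split; apply SS; assumption.
    + apply cauchy_riemann_holomorphic; auto; apply cauchy_riemann_scale; assumption.
    + apply cauchy_riemann_holomorphic; auto; apply cauchy_riemann_scale; assumption.
    + intros q v [_ Hq]; revert v; apply quadratic_normal_form_iff.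
      rewrite E by exact Hq; unfold goursat; simpl.
      rewrite !scale3_inv by (apply Rinv_r, sqrt2_neq); reflexivity.
  - intros H p Hp.
    destruct (H p Hp) as [N [O [alpha [beta [HN [Np [_ [HO [HNO
      [[Sa1 Sa2] [[Sb1 Sb2] [Ha [Hb E]]]]]]]]]]]]].
    set (D := fun y : E3 => O (scale3 (/ sqrt 2) y)).
    assert (HD : open D) by (apply open_scale3, HO).
    set (D' := fun y : E3 => exists q : E4, N q /\ xxu q = y).
    assert (HD' : open D') by (apply open_image, HN).
    assert (DD : forall y, D' y -> D y).
    { intros y [q [Hq <-]]; unfold D; rewrite <- zu_scale3; apply HNO, Hq. }
    assert (Dp : D' (xxu p)) by (exists p; split; [exact Np|reflexivity]).
    apply holomorphic_cauchy_riemann in Ha, Hb.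
    rewrite (lap_ext D' _ (lap (goursat (fun y => Re (alpha (scale3 (/ sqrt 2) y)))
       (fun y => Im (alpha (scale3 (/ sqrt 2) y)))
       (fun y => Re (beta (scale3 (/ sqrt 2) y))))) _ HD'); [| |exact Dp].
    + apply (biharmonic_goursat D _ _ _ (fun y => Im (beta (scale3 (/ sqrt 2) y)))).
      * exact HD.
      * exact (smooth_scale _ O _ HO Sa1).
      * exact (smooth_scale _ O _ HO Sa2).
      * exact (smooth_scale _ O _ HO Sb1).
      * exact (smooth_scale _ O _ HO Sb2).
      * exact (cauchy_riemann_scale _ O _ _ Sa1 Sa2 Ha).
      * exact (cauchy_riemann_scale _ O _ _ Sb1 Sb2 Hb).
      * apply DD, Dp.
    + intros y Hy; apply (lap_ext D'); [exact HD'| |exact Hy].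
      intros z [q [Hq <-]]; apply quadratic_normal_form_iff; intros v; apply E, Hq.
Qed.
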